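(* Let $\Gamma(i+\tfrac12)\in\mathbb{R}^2$, $0\le i\le N$, be a planar equal-area polygon, let $\gamma(i)=\Gamma'(i)$, write its discrete affine curvature as $\lambda(i)+\mu_0$ with $\mu_0$ a real constant, let $P\in\mathbb{R}^2$, and let $z(i)=[\Gamma(i+\tfrac12)-P,\gamma(i)]$ be the support function of $\Gamma$ with respect to $P$. Then the polygonal line $\phi(i)=(\gamma(i),z(i))\in\mathbb{R}^3$, $1\le i\le N$, satisfies the difference equations $$\gamma''(i)=-(\lambda(i)+\mu_0)\gamma(i),\qquad z''(i)=-(\lambda(i)+\mu_0)z(i)+1,\qquad 2\le i\le N-1.$$ Conversely, any solution $\phi(i)=(\gamma(i),z(i))\in\mathbb{R}^2\times\mathbb{R}$, $1\le i\le N$, of these difference equations (for some scalar function $\lambda$ and constant $\mu_0$), normalized so that $[\gamma(i),\gamma(i+1)]=1$ for all $1\le i\le N-1$, is obtained by this construction, for some planar polygon $\Gamma(i+\tfrac12)$ and some point $P\in\mathbb{R}^2$.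
   Context: Here $[\cdot,\cdot]$ denotes the determinant of two vectors of $\mathbb{R}^2$. Primes denote differences: $\Gamma'(i)=\Gamma(i+\tfrac12)-\Gamma(i-\tfrac12)$, $f'(i+\tfrac12)=f(i+1)-f(i)$, $f''(i)=f'(i+\tfrac12)-f'(i-\tfrac12)=f(i+1)-2f(i)+f(i-1)$. A planar polygon $\Gamma$ is equal-area if $[\Gamma'(i),\Gamma'(i+1)]=1$ for all $1\le i\le N-1$; then $\Gamma'''(i)=\gamma''(i)$ is a multiple of $\Gamma'(i)=\gamma(i)$, and the discrete affine curvature of $\Gamma$ at $i$ is the scalar $\kappa(i)$ with $\Gamma'''(i)=-\kappa(i)\Gamma'(i)$, $2\le i\le N-1$. The affine distance, or support function, of $\Gamma$ with respect to $P$ is $z(i)=[\Gamma(i+\tfrac12)-P,\gamma(i)]=[\Gamma(i-\tfrac12)-P,\gamma(i)]$. *)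

(* Defs.v *)
From mathcomp Require Import all_boot all_order all_algebra.
From mathcomp Require Import boolp classical_sets reals.

Set Implicit Arguments.
Unset Strict Implicit.
Unset Printing Implicit Defensive.

Import GRing.Theory.
Local Open Scope ring_scope.

(* A sequence indexed by the integers i is f : nat -> V, with f i standing for
   f(i).  A sequence indexed by the half-integers i + 1/2 is F : nat -> V, with
   F i standing for F(i + 1/2); thus F(i - 1/2) is F i.-1, used only for
   1 <= i.  Finite ranges of indices are imposed by explicit bounds, so values
   outside these ranges are irrelevant. *)

(* f'(i + 1/2) = f(i + 1) - f(i) *)
Definition diff_at_half (V : zmodType) (f : nat -> V) : nat -> V :=
  fun i => f i.+1 - f i.

(* F'(i) = F(i + 1/2) - F(i - 1/2) *)
Definition diff_at_int (V : zmodType) (F : nat -> V) : nat -> V :=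
  fun i => F i - F i.-1.

(* f''(i) = f'(i + 1/2) - f'(i - 1/2) *)
Definition second_diff (V : zmodType) (f : nat -> V) : nat -> V :=
  diff_at_int (diff_at_half f).

Definition bracket (R : realType) (u v : 'rV[R]_2) : R :=
  \det (col_mx u v : 'M[R]_2).

Definition unit_brackets (R : realType) (N : nat) (g : nat -> 'rV[R]_2) : Prop :=
  forall i : nat, (1 <= i <= N - 1)%N -> bracket (g i) (g i.+1) = 1.

Definition equal_area (R : realType) (N : nat) (G : nat -> 'rV[R]_2) : Prop :=
  unit_brackets N (diff_at_int G).

(* The scalar k with G'''(i) = - k G'(i), as a definite description: its
   existence and uniqueness for an equal-area polygon and 2 <= i <= N - 1
   are not built in (if no such k exists the value is 0). *)
Definition affine_curvature (R : realType) (G : nat -> 'rV[R]_2) (i : nat) : R :=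
  xget 0 [set k : R |
    second_diff (diff_at_int G) i = - k *: diff_at_int G i]%classic.

Definition support_function (R : realType) (G : nat -> 'rV[R]_2) (P : 'rV[R]_2)
    (i : nat) : R :=
  bracket (G i - P) (diff_at_int G i).

Definition curvature_is (R : realType) (N : nat) (G : nat -> 'rV[R]_2)
    (lambda : nat -> R) (mu0 : R) : Prop :=
  forall i : nat, (2 <= i <= N - 1)%N -> affine_curvature G i = lambda i + mu0.

Definition difference_equations (R : realType) (N : nat) (lambda : nat -> R)
    (mu0 : R) (phi : nat -> 'rV[R]_2 * R) : Prop :=
  let gamma := fun i => (phi i).1 in
  let z := fun i => (phi i).2 in
  forall i : nat, (2 <= i <= N - 1)%N ->
    second_diff gamma i = - (lambda i + mu0) *: gamma i /\
    second_diff z i = - (lambda i + mu0) * z i + 1.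

(* Main.v *)
Require Import Defs.
From mathcomp Require Import all_boot all_order all_algebra.
From mathcomp Require Import boolp classical_sets reals.
From mathcomp Require Import ring zify.

Import GRing.Theory.
Local Open Scope ring_scope.

(** Write [u, v] for the bracket and g for the difference of G, and let z be
    the support function of G.  Three facts carry the proof.

    A pair u, v with [u, v] = 1 is a basis, and the coordinates of w in it are
    brackets: w = [w, v] u + [u, w] v ([unit_bracket_expand]).  Now
    [g(i), g''(i)] = [g(i), g(i+1)] - [g(i-1), g(i)] vanishes for an equal-area
    polygon, so g''(i) is a multiple of g(i); hence the affine curvature is
    genuinely characterised by the equation that it is supposed to solve
    ([affine_curvatureP], [affine_curvature_unique]).

    Bilinearity alone gives z''(i) = [G(i) - P, g''(i)] + [g(i-1), g(i)]
    ([second_diff_support_function]): the point G(i-1) that enters z(i-1)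
    differs from G(i) by g(i), and this produces the inhomogeneous term.
    Together with g'' = - kappa g this is the equation for z.

    Conversely, summing g gives a polygon with difference g, unique up to
    translation.  The translation, or equivalently P, is the two-parameter
    freedom that adjusts z(1) and z(2), because g(1), g(2) is a basis.  The
    support function of this polygon solves the same second-order recurrence
    as the prescribed z, so the two agree everywhere once they agree at 1 and 2
    ([second_order_recurrence_unique]). *)

Section Bracket.
Variable R : realType.
Implicit Types u v w : 'rV[R]_2.

Lemma det_mx22E (M : 'M[R]_2) : \det M = M 0 0 * M 1 1 - M 0 1 * M 1 0.
Proof.
rewrite (expand_det_row _ 0) !big_ord_recl big_ord0 /cofactor !det_mx11 !mxE /=.
have -> : lift 0 0 = 1 :> 'I_2 by apply: val_inj.
have -> : lift 1 0 = 0 :> 'I_2 by apply: val_inj.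
by rewrite addr0 expr0 mul1r expr1 mulN1r mulrN.
Qed.

Lemma bracketE u v : bracket u v = u 0 0 * v 0 1 - u 0 1 * v 0 0.
Proof.
have up j : (col_mx u v : 'M_2) 0 j = u 0 j.
  by rewrite -(col_mxEu u v); congr (col_mx u v _ j); apply: val_inj.
have down j : (col_mx u v : 'M_2) 1 j = v 0 j.
  by rewrite -(col_mxEd u v); congr (col_mx u v _ j); apply: val_inj.
by rewrite /bracket det_mx22E !up !down.
Qed.

Lemma unit_bracket_neq0 u v : bracket u v = 1 -> u != 0.
Proof.
move=> uv1; apply/eqP=> u0; move: uv1; rewrite u0 bracketE !mxE !mul0r subr0.
by move/esym/eqP; rewrite oner_eq0.
Qed.

(** Cramer's rule in a basis of determinant one. *)
Lemma unit_bracket_expand u v w :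
  bracket u v = 1 -> w = bracket w v *: u + bracket u w *: v.
Proof.
rewrite !bracketE => uv1; apply/rowP=> j; rewrite !mxE -[LHS]mulr1 -uv1.
have [->|->] : j = 0 \/ j = 1.
- by case: j => [[|[|//]] lt_j2]; [left | right]; apply: val_inj.
- by ring.
by ring.
Qed.

End Bracket.

Section SecondDifference.
Variable V : zmodType.

Lemma second_diffE (f : nat -> V) i :
  (1 <= i)%N -> second_diff f i = f i.+1 - f i - (f i - f i.-1).
Proof. by case: i. Qed.

Lemma eq_second_diff (f h : nat -> V) n i :
  (forall j, (1 <= j <= n)%N -> f j = h j) ->
  (2 <= i <= n - 1)%N -> second_diff f i = second_diff h i.
Proof. by move=> eq_fh i_in; rewrite !second_diffE ?eq_fh //; lia. Qed.

(** The recurrence determines f(i+1) from f(i) and f(i-1). *)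
Lemma second_order_recurrence_unique (F : nat -> V -> V) (f h : nat -> V) n :
  f 1%N = h 1%N -> f 2%N = h 2%N ->
  (forall i, (2 <= i <= n - 1)%N -> second_diff f i = F i (f i)) ->
  (forall i, (2 <= i <= n - 1)%N -> second_diff h i = F i (h i)) ->
  forall i, (1 <= i <= n)%N -> f i = h i.
Proof.
move=> eq1 eq2 rec_f rec_h; elim/ltn_ind=> -[|[|[|i]]] IH // i_in.
have i2_in : (2 <= i.+2 <= n - 1)%N by lia.
have eq_i1 : f i.+1 = h i.+1 by apply: IH; lia.
have eq_i2 : f i.+2 = h i.+2 by apply: IH; lia.
have := rec_f _ i2_in; rewrite eq_i2 -rec_h // !second_diffE //= eq_i1 eq_i2.
by move/addIr/addIr.
Qed.

End SecondDifference.

Section Polygon.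
Variable R : realType.
Implicit Types (G g : nat -> 'rV[R]_2) (P : 'rV[R]_2).

(** By the two unit brackets around i, the second difference has no component
    along g(i+1) in the basis g(i), g(i+1). *)
Lemma second_diff_parallel N g i :
  unit_brackets N g -> (2 <= i <= N - 1)%N ->
  exists k : R, second_diff g i = - k *: g i.
Proof.
move=> unit_g i_in; have gi1 : bracket (g i) (g i.+1) = 1 by apply: unit_g; lia.
have gi0 : bracket (g i.-1) (g i) = 1.
  by rewrite -[in X in bracket _ X](@prednK i) ?unit_g //; lia.
exists (- bracket (second_diff g i) (g i.+1)); rewrite opprK.
rewrite {1}(unit_bracket_expand _ _ _ (second_diff g i) gi1).
suff -> : bracket (g i) (second_diff g i) = 0 by rewrite scale0r addr0.
rewrite second_diffE; last by lia.
move: gi1 gi0; rewrite !bracketE !mxE => gi1 gi0.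
transitivity ((1 : R) - 1); last exact: subrr.
by rewrite -{1}gi1 -gi0; ring.
Qed.

Lemma affine_curvatureP N G i :
  equal_area N G -> (2 <= i <= N - 1)%N ->
  second_diff (diff_at_int G) i = - affine_curvature G i *: diff_at_int G i.
Proof.
move=> unit_G /(second_diff_parallel _ _ _ unit_G)[k def_k].
by rewrite /affine_curvature; case: xgetP => [_ _ //|/(_ k)/(_ def_k)].
Qed.

Lemma affine_curvature_unique G i (k : R) :
  diff_at_int G i != 0 ->
  second_diff (diff_at_int G) i = - k *: diff_at_int G i ->
  affine_curvature G i = k.
Proof.
move=> nz_g def_k; apply: xget_unique => //= k'; rewrite def_k.
move/eqP; rewrite -subr_eq0 -scalerBl scaler_eq0 (negPf nz_g) orbF subr_eq0.
by rewrite eqr_opp => /eqP.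
Qed.

(** G(i-1) - P = (G(i) - P) - g(i), and the correction g(i) contributes to
    z(i-1) but not to z(i), since [g(i), g(i)] = 0. *)
Lemma second_diff_support_function G P i :
  (2 <= i)%N ->
  second_diff (support_function G P) i =
    bracket (G i - P) (second_diff (diff_at_int G) i)
      + bracket (diff_at_int G i.-1) (diff_at_int G i).
Proof.
case: i => [|[|i]] // _; rewrite !second_diffE // /support_function.
by rewrite /diff_at_int /= !bracketE !mxE; ring.
Qed.

Lemma support_function_recurrence N G P i :
  equal_area N G -> (2 <= i <= N - 1)%N ->
  second_diff (support_function G P) i =
    - affine_curvature G i * support_function G P i + 1.
Proof.
move=> unit_G i_in; rewrite second_diff_support_function; last by lia.
rewrite (affine_curvatureP N) //; congr (_ + _).
  by rewrite /support_function !bracketE !mxE; ring.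
have := unit_G i.-1; rewrite prednK; last by lia.
by apply; lia.
Qed.

Definition polygon_from (A : 'rV[R]_2) g (i : nat) : 'rV[R]_2 :=
  A + \sum_(1 <= j < i.+1) g j.

Lemma diff_polygon_from A g i :
  (1 <= i)%N -> diff_at_int (polygon_from A g) i = g i.
Proof.
case: i => // i _; rewrite /diff_at_int /polygon_from /=.
by rewrite big_nat_recr //= addrA [LHS]addrC addKr.
Qed.

(** The second vertex V lies on the edges g(1) and g(2), so both support values
    can be read off it: [V, g(1)] = z1 and [V, g(2)] = z2.  In the basis g(1),
    g(2) this forces V = z2 g(1) - z1 g(2). *)
Lemma polygon_with_initial_support g (z1 z2 : R) :
  bracket (g 1%N) (g 2%N) = 1 ->
  exists A : 'rV[R]_2,
    support_function (polygon_from A g) 0 1 = z1 /\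
    support_function (polygon_from A g) 0 2 = z2.
Proof.
move=> g12.
(* The first vertex, A = V - g(1). *)
exists (z2 *: g 1%N - z1 *: g 2%N - g 1%N).
rewrite /support_function !diff_polygon_from // /polygon_from.
rewrite big_nat1 (@big_nat_recr _ _ _ 2) //= big_nat1.
move: g12; rewrite !bracketE !mxE => g12.
by split; rewrite -[RHS]mulr1 -g12; ring.
Qed.

End Polygon.

Theorem proposition3p7 (R : realType) (N : nat) :
  (forall (G : nat -> 'rV[R]_2) (lambda : nat -> R) (mu0 : R) (P : 'rV[R]_2),
      equal_area N G ->
      curvature_is N G lambda mu0 ->
      difference_equations N lambda mu0
        (fun i => (diff_at_int G i, support_function G P i)))
  /\
  ((2 <= N)%N ->
   forall (phi : nat -> 'rV[R]_2 * R) (lambda : nat -> R) (mu0 : R),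
      difference_equations N lambda mu0 phi ->
      unit_brackets N (fun i => (phi i).1) ->
      exists (G : nat -> 'rV[R]_2) (P : 'rV[R]_2),
        [/\ equal_area N G,
            curvature_is N G lambda mu0 &
            forall i : nat, (1 <= i <= N)%N ->
              phi i = (diff_at_int G i, support_function G P i)]).
Proof.
split=> [G lambda mu0 P unit_G curv_G g z i i_in|N_ge2 phi lambda mu0 eqs unit_g].
  rewrite {}/g {}/z /= -curv_G //.
  split; first exact: (affine_curvatureP _ N).
  exact: (support_function_recurrence _ N).
set g := fun i => (phi i).1 in unit_g; set z := fun i => (phi i).2.
have g12 : bracket (g 1%N) (g 2%N) = 1 by apply: unit_g; lia.
have [A [z1 z2]] := polygon_with_initial_support _ _ (z 1%N) (z 2%N) g12.
set G := polygon_from _ A g in z1 z2.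
have dG i : (1 <= i)%N -> diff_at_int G i = g i by exact: diff_polygon_from.
have unit_G : equal_area N G.
  by move=> i i_in; rewrite !dG ?unit_g //; lia.
have curv_G : curvature_is N G lambda mu0.
  move=> i i_in; apply: affine_curvature_unique.
    by apply: (@unit_bracket_neq0 _ _ (diff_at_int G i.+1)); apply: unit_G; lia.
  have [g_eq _] := eqs i i_in.
  rewrite dG; last by lia.
  by rewrite (eq_second_diff _ _ g N) // => j j_in; apply: dG; lia.
exists G, 0; split=> // i i_in; rewrite dG; last by lia.
rewrite [LHS]surjective_pairing; congr pair.
pose F i (x : R) := - (lambda i + mu0) * x + 1.
apply: (second_order_recurrence_unique _ F z (support_function G 0) N) => //.
  by move=> j j_in; have [] := eqs j j_in.
by move=> j j_in; rewrite /F -curv_G //; apply: (support_function_recurrence _ N).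
Qed.
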